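(* Fix data vectors $a_1,\dots,a_n\in\mathbb{R}^d$ and an epoch length $m\ge 1$, and consider the algorithm VR HB Power described in the context. There are real constants $c_1,\dots,c_m$, not depending on the step size $\eta$, the mini-batch size $|S|\in\{1,\dots,n\}$ (hence not on $K$), the initial vector $\tilde w_0$, or the number of epochs $s$, such that, with $$\rho(\eta,K)=\frac{p_m(\alpha_2(\eta),\beta(\eta))}{p_m(\alpha_1(\eta),\beta(\eta))}+\eta^4\sum_{l=1}^m c_lK^l ,$$ the following holds. For every mini-batch size there exists $\bar\eta(K)\in(0,1]$ such that for every $\eta\in(0,\bar\eta(K)]$ we have $0<\rho(\eta,K)<1$ and, if the algorithm is executed for $s$ epochs with step size $\eta$ and momentum $\beta(\eta)$ starting from a (deterministic) unit vector $\tilde w_0$ with $u_1^T\tilde w_0\neq 0$, then $$\frac{\sum_{k=2}^d E[(u_k^T\tilde w_s)^2]}{E[(u_1^T\tilde w_s)^2]}\le \rho(\eta,K)^s\left(\frac{1-(u_1^T\tilde w_0)^2}{(u_1^T\tilde w_0)^2}\right).$$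
   Context: Setting. $d\ge 2$; $a_1,\dots,a_n\in\mathbb{R}^d$; $C=\frac1n\sum_{i=1}^n a_ia_i^T$ has eigenvalues $\lambda_1>\lambda_2\ge\dots\ge\lambda_d\ge0$ with corresponding orthonormal eigenvectors $u_1,\dots,u_d$. $\|\cdot\|$ is the Euclidean norm for vectors and the spectral norm for matrices. For $\eta\in(0,1]$: $\alpha_k(\eta)=4(1-\eta+\eta\lambda_k)^2$ for $1\le k\le d$, and $\beta(\eta)=(1-\eta+\eta\lambda_2)^2$. The recurrence polynomials $p_t(\alpha,\beta)$ are defined by $p_0=1$, $p_1=\frac{\alpha}{4}$, $p_2=(\frac{\alpha}{2}-\beta)^2$ and $p_t=(\alpha-\beta)p_{t-1}-\beta(\alpha-\beta)p_{t-2}+\beta^3p_{t-3}$ for $t\ge3$. Algorithm VR HB Power (step size $\eta\in(0,1]$, momentum $\beta(\eta)$, mini-batch size $|S|\in\{1,\dots,n\}$, epoch length $m\ge1$). Given $\tilde w_0$, for $s=0,1,2,\dots$ perform one epoch: set $\tilde g=C\tilde w_s$, $w_0=\tilde w_s$, $w_1=(1-\eta)w_0+\eta\tilde g$; for $t=1,\dots,m-1$ draw a mini-batch $S_t$ of size $|S|$ from $\{1,\dots,n\}$ uniformly at random (with or without replacement, the scheme being fixed), and set $$g_t=\frac1{|S_t|}\sum_{l\in S_t}a_la_l^T\Big(w_t-\frac{w_t^Tw_0}{\|w_0\|^2}w_0\Big)+\frac{w_t^Tw_0}{\|w_0\|^2}\tilde g,\qquad w_{t+1}=2\big((1-\eta)w_t+\eta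 g_t\big)-\beta(\eta)w_{t-1};$$ finally $\tilde w_{s+1}=w_m$. All mini-batches, over all inner iterations and epochs, are independent and identically distributed. If $w_0=0$, quotients by $\|w_0\|^2$ are read as $0$ (so all iterates of that epoch are $0$). $C_t=\frac1{|S_t|}\sum_{l\in S_t}a_la_l^T$, so that $E[C_t]=C$, and $K=\|E[(C_t-C)^2]\|$ (independent of $t$). *)

(* Defs.v *)
From HB Require Import structures.
From mathcomp Require Import all_boot all_order all_algebra.
From mathcomp Require Import all_classical all_reals all_analysis.

Set Implicit Arguments.
Unset Strict Implicit.
Unset Printing Implicit Defensive.

Import Order.TTheory GRing.Theory Num.Theory.

Local Open Scope classical_set_scope.
Local Open Scope ring_scope.

Definition dot (R : realType) (d : nat) (x y : 'cV[R]_d) : R :=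
  (x^T *m y) ord0 ord0.

(* The library norm on matrices and vectors is the sup norm of the entries. *)
Definition norm2 (R : realType) (d : nat) (x : 'cV[R]_d) : R :=
  Num.sqrt (dot x x).

Definition spectral_norm (R : realType) (d : nat) (A : 'M[R]_d) : R :=
  sup [set norm2 (A *m x) | x in [set x : 'cV[R]_d | norm2 x <= 1]].

Definition covariance_mx (R : realType) (d n : nat) (a : 'I_n -> 'cV[R]_d) :
    'M[R]_d :=
  n%:R^-1 *: \sum_(i < n) a i *m (a i)^T.

Definition orthonormal_eigenbasis (R : realType) (d : nat) (A : 'M[R]_d)
    (lam : 'I_d -> R) (u : 'I_d -> 'cV[R]_d) : Prop :=
  (forall k, A *m u k = lam k *: u k) /\
  (forall j k, dot (u j) (u k) = (j == k)%:R).

Section Coefficients.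
Variable R : realType.
Implicit Types eta l al be : R.

(* [alpha_par eta (lambda_k)] is alpha_k(eta); [beta_par eta (lambda_2)] is
   beta(eta). *)
Definition alpha_par eta l : R := 4 * (1 - eta + eta * l) ^+ 2.
Definition beta_par eta l : R := (1 - eta + eta * l) ^+ 2.

Fixpoint rec_poly (t : nat) al be {struct t} : R :=
  match t with
  | 0 => 1
  | t1.+1 => match t1 with
    | 0 => al / 4
    | t2.+1 => match t2 with
      | 0 => (al / 2 - be) ^+ 2
      | t3.+1 => (al - be) * rec_poly t1 al be
                 - be * (al - be) * rec_poly t2 al be
                 + be ^+ 3 * rec_poly t3 al be
      end
    end
  end.

End Coefficients.

Inductive sampling := with_replacement | without_replacement.

(* A mini-batch is the tuple of the indices drawn, in the order of the draws.
   Without replacement it ranges over the repetition-free tuples: every subset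
   of size b comes from exactly b! of them, so the uniform law on these tuples
   gives the uniform law on subsets of size b, and the order plays no role in
   the mini-batch averages. *)
Definition minibatches (n : nat) (sch : sampling) (b : nat) :
    {set b.-tuple 'I_n} :=
  match sch with
  | with_replacement => [set: b.-tuple 'I_n]%SET
  | without_replacement => [set B : b.-tuple 'I_n | uniq B]%SET
  end.

Section Algorithm.
Variables (R : realType) (d n b : nat) (a : 'I_n -> 'cV[R]_d).

Definition batch_mx (B : b.-tuple 'I_n) : 'M[R]_d :=
  b%:R^-1 *: \sum_(l <- B) a l *m (a l)^T.

Definition batch_variance (sch : sampling) : 'M[R]_d :=
  #|minibatches n sch b|%:R^-1 *:
    \sum_(B in minibatches n sch b)
      (batch_mx B - covariance_mx a) *m (batch_mx B - covariance_mx a).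

Definition variance_norm (sch : sampling) : R :=
  spectral_norm (batch_variance sch).

(* Since 0^-1 = 0, the coefficient is 0 when w0 = 0. *)
Definition proj_coef (w0 w : 'cV[R]_d) : R := dot w w0 / norm2 w0 ^+ 2.

Definition vr_gradient (w0 : 'cV[R]_d) (B : b.-tuple 'I_n) (w : 'cV[R]_d) :
    'cV[R]_d :=
  batch_mx B *m (w - proj_coef w0 w *: w0)
  + proj_coef w0 w *: (covariance_mx a *m w0).

(* The t-th inner iterate w_t of an epoch started at w0, where [S t] is the
   mini-batch of the inner iteration t >= 1. *)
Fixpoint inner_iter (eta be : R) (w0 : 'cV[R]_d) (S : nat -> b.-tuple 'I_n)
    (t : nat) {struct t} : 'cV[R]_d :=
  match t with
  | 0 => w0
  | t1.+1 => match t1 with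
    | 0 => (1 - eta) *: w0 + eta *: (covariance_mx a *m w0)
    | t2.+1 =>
      2 *: ((1 - eta) *: inner_iter eta be w0 S t1
            + eta *: vr_gradient w0 (S t1) (inner_iter eta be w0 S t1))
      - be *: inner_iter eta be w0 S t2
    end
  end.

(* [S e t] is the mini-batch of the inner iteration t of the epoch e. *)
Fixpoint vr_hb_power (eta be : R) (m : nat) (w0 : 'cV[R]_d)
    (S : nat -> nat -> b.-tuple 'I_n) (s : nat) {struct s} : 'cV[R]_d :=
  match s with
  | 0 => w0
  | e.+1 => inner_iter eta be (vr_hb_power eta be m w0 S e) (S e) m
  end.

End Algorithm.

Section RandomMinibatches.
Variables (R : realType) (disp : measure_display) (T : measurableType disp).
Variables (P : probability T R) (n b : nat).

Definition uniform_minibatch (sch : sampling) (X : T -> b.-tuple 'I_n) : Prop :=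
  (forall A : set (b.-tuple 'I_n), measurable (X @^-1` A)) /\
  (forall B : b.-tuple 'I_n, P (X @^-1` [set B]) =
     (if B \in minibatches n sch b then #|minibatches n sch b|%:R^-1
      else 0)%:E).

(* The mini-batches of the inner iterations t = 1, ..., m - 1 of the epochs
   e = 0, ..., s - 1, as random variables on T. *)
Definition iid_minibatches (sch : sampling) (m s : nat)
    (S : nat -> nat -> T -> b.-tuple 'I_n) : Prop :=
  (forall e t, (e < s)%N -> (0 < t < m)%N -> uniform_minibatch sch (S e t)) /\
  (forall (J : seq (nat * nat)) (A : nat * nat -> set (b.-tuple 'I_n)),
     uniq J -> (forall j, j \in J -> (j.1 < s)%N && (0 < j.2 < m)%N) ->
     P (\bigcap_(j in [set` J]) (S j.1 j.2 @^-1` A j)) =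
     (\prod_(j <- J) P (S j.1 j.2 @^-1` A j))%E).

(* Real-valued expectation of the square of the coordinate of W along v; the
   W of interest takes finitely many values, so ['E_P] is finite there. *)
Definition mean_sq_coord (d : nat) (v : 'cV[R]_d) (W : T -> 'cV[R]_d) : R :=
  fine ('E_P[(fun x => (dot v (W x) ^+ 2)%R)])%E.

End RandomMinibatches.

(* Main.v *)
Require Import Defs.
From mathcomp Require Import all_boot all_order all_algebra all_fingroup.
From mathcomp Require Import all_classical all_reals all_analysis.
From mathcomp Require Import measurable_realfun ring lra.
Set Implicit Arguments.
Unset Strict Implicit.
Unset Printing Implicit Defensive.
Import Order.TTheory GRing.Theory Num.Theory.
Local Open Scope ring_scope.

(** Write [C] for the covariance, [y_t = w_t - proj w_t] for the component of
    an inner iterate orthogonal to the start [w0] of its epoch, and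
    [N_t = C_t - C] for the mini-batch noise.  The variance-reduced gradient is
    [g_t = C w_t + N_t y_t], so that

      [w_(t+1) = 2 ((1 - eta) w_t + eta C w_t) - beta w_(t-1) + 2 eta N_t y_t].

    Without noise, each eigencoordinate follows a scalar Chebyshev recurrence
    [q_t] with parameter [x_k = 1 - eta + eta lambda_k], and the polynomial
    [p_t] of the statement is its square (lemma [rec_poly_cheb]).  Since
    [beta = x_2^2], the recurrence gives [q_t(x_k)^2 <= beta^t = p_t(alpha_2)]
    for every non-leading coordinate (lemmas [cheb_sqr_le], [cheb_geom]),
    whereas the leading one grows: [q_t(x_1) >= x_1^t] (lemma [cheb_ge]).

    The accumulated noise [err_t] has zero mean given the start of the epoch,
    because [N_t] is centred and independent of the past.  Hence the second
    moment of a coordinate at the end of an epoch is exactly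
    [q_m(x_k)^2 E(u_k . w0)^2 + E(u_k . err_m)^2] (lemma [epoch_coord]).
    The noise only helps the leading coordinate; on the others it costs at most
    [E |err_m|^2], and this is where variance reduction yields the fourth power
    of [eta].  The vectors [y_t] start from [0] and are fed by the part of
    [eta C w0] orthogonal to [w0], which vanishes when [w0] is the leading
    eigenvector; so [|y_t|^2 = O(eta^2 tail(w0))] for all choices of the
    mini-batches, where [tail] is the squared mass on the non-leading
    coordinates (lemma [sqn_iter_resid_le]).  The noise injected at a step is
    [2 eta N_t y_t], of mean square at most [4 eta^2 K E |y_t|^2], whence
    [E |err_m|^2 = O(eta^4 K E(tail(w0)))] (lemma [expect_err_sqn]).

    One epoch thus multiplies the mean tail by at most
    [p_m(alpha_2) + O(eta^4 K)] and the mean squared leading coordinate by at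
    least [p_m(alpha_1)].  As [p_m(alpha_1) >= 4^-m] for [eta <= 1/2], the
    quotient of the two factors is bounded by [rho] with a single nonzero
    constant [c_1]; the powers [K^l] with [l >= 2] get coefficient [0].
    Finally [rho < 1] for small [eta], because the spectral gap makes
    [p_m(alpha_2) / p_m(alpha_1)] smaller than [1] by at least a fixed
    multiple of [eta], against a perturbation of order [eta^4].

    All the randomness is finite: the mini-batches take finitely many values, so
    expectations are computed as finite weighted sums over all their values
    (lemma [expectation_samples]). *)

(** * Euclidean geometry in coordinates *)

Section EuclideanSpace.
Variables (R : realType) (d : nat).
Implicit Types (x y z : 'cV[R]_d) (A : 'M[R]_d) (k : R).

(** The whole proof runs on squared Euclidean norms: constants are irrelevant
    except along eigendirections, and there second moments add up exactly. *)
Definition sqn x : R := dot x x.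

Lemma dotE x y : dot x y = \sum_i x i 0 * y i 0.
Proof. by rewrite /dot mxE; apply: eq_bigr => i _; rewrite mxE. Qed.

Lemma dotC x y : dot x y = dot y x.
Proof. by rewrite !dotE; apply: eq_bigr => i _; rewrite mulrC. Qed.

Lemma dotDr x y z : dot x (y + z) = dot x y + dot x z.
Proof. by rewrite /dot mulmxDr mxE. Qed.

Lemma dotZr k x y : dot x (k *: y) = k * dot x y.
Proof. by rewrite /dot -scalemxAr mxE. Qed.

Lemma dotNr x y : dot x (- y) = - dot x y.
Proof. by rewrite /dot mulmxN mxE. Qed.

Lemma dotBr x y z : dot x (y - z) = dot x y - dot x z.
Proof. by rewrite dotDr dotNr. Qed.

Lemma dotDl x y z : dot (x + y) z = dot x z + dot y z.
Proof. by rewrite dotC dotDr !(dotC z). Qed.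

Lemma dotBl x y z : dot (x - y) z = dot x z - dot y z.
Proof. by rewrite dotC dotBr !(dotC z). Qed.

Lemma dotZl k x y : dot (k *: x) y = k * dot x y.
Proof. by rewrite dotC dotZr dotC. Qed.

Lemma dot0r x : dot x 0 = 0.
Proof. by rewrite /dot mulmx0 mxE. Qed.

Lemma dot_sumr (I : Type) (s : seq I) (P : pred I) (f : I -> 'cV[R]_d) x :
  dot x (\sum_(i <- s | P i) f i) = \sum_(i <- s | P i) dot x (f i).
Proof.
apply: (big_morph (dot x)) => [y z|]; [exact: dotDr|exact: dot0r].
Qed.

Lemma dot_mulmx A x y : dot x (A *m y) = dot (A^T *m x) y.
Proof. by rewrite /dot trmx_mul trmxK mulmxA. Qed.

Lemma sqn_ge0 x : 0 <= sqn x.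
Proof. by rewrite /sqn dotE sumr_ge0 // => i _; rewrite -expr2 sqr_ge0. Qed.

Lemma sqn_eq0 x : sqn x = 0 -> x = 0.
Proof.
move=> /eqP; rewrite /sqn dotE psumr_eq0 => [|i _]; last first.
  by rewrite -expr2 sqr_ge0.
move=> /allP x0; apply/matrixP => i j; rewrite ord1 mxE.
by have := x0 i (mem_index_enum i); rewrite /= mulf_eq0 orbb => /eqP.
Qed.

Lemma norm2_sqr x : norm2 x ^+ 2 = sqn x.
Proof. by rewrite /norm2 sqr_sqrtr // sqn_ge0. Qed.

Lemma norm2_ge0 x : 0 <= norm2 x. Proof. exact: sqrtr_ge0. Qed.

Lemma sqn0 : sqn 0 = 0. Proof. by rewrite /sqn dot0r. Qed.

Lemma sqnZ k x : sqn (k *: x) = k ^+ 2 * sqn x.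
Proof. by rewrite /sqn dotZl dotZr mulrA expr2. Qed.

Lemma sqnD_le x y : sqn (x + y) <= 2 * sqn x + 2 * sqn y.
Proof.
have := sqn_ge0 (x - y); rewrite /sqn dotBl !dotBr dotDl !dotDr (dotC y x).
lra.
Qed.

(** Cauchy-Schwarz for the number of terms; the induction step is the
    nonnegativity of the square norm of [n f_i - S]. *)
Lemma sqn_sum_le (I : Type) (s : seq I) (f : I -> 'cV[R]_d) :
  sqn (\sum_(i <- s) f i) <= (size s)%:R * \sum_(i <- s) sqn (f i).
Proof.
elim: s => [|i s IH]; first by rewrite !big_nil sqn0 mulr0.
rewrite !big_cons /=.
set S := \sum_(j <- s) f j in IH *; set Q := \sum_(j <- s) _ in IH *.
have Q0 : 0 <= Q by apply: sumr_ge0 => j _; exact: sqn_ge0.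
have [s0|s0] := posnP (size s).
  have S0 : S = 0 by rewrite /S (size0nil s0) big_nil.
  by rewrite S0 addr0 s0 mul1r lerDl.
have n0 : 0 < (size s)%:R :> R by rewrite ltr0n.
rewrite -natr1; set n := (size s)%:R in IH n0 *.
have := sqn_ge0 (n *: f i - S).
rewrite /sqn dotBl !dotBr dotDl !dotDr !dotZl !dotZr (dotC S) -!/(sqn _) => h.
rewrite -(ler_pM2l n0); nra.
Qed.

Lemma cauchy_schwarz x y : dot x y ^+ 2 <= sqn x * sqn y.
Proof.
have [y0|y0] := eqVneq (sqn y) 0.
  by rewrite (sqn_eq0 y0) dot0r expr0n sqn0 mulr0.
have y1 : 0 < sqn y by rewrite lt_neqAle eq_sym y0 sqn_ge0.
have := sqn_ge0 (sqn y *: x - dot x y *: y).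
rewrite {1}/sqn dotBl !dotBr !dotZl !dotZr (dotC y x) -!/(sqn _) => h.
rewrite -(ler_pM2l y1); nra.
Qed.

Lemma dot_le_norm2 x y : dot x y <= norm2 x * norm2 y.
Proof.
apply: le_trans (ler_norm _) _.
rewrite -(@ler_pXn2r _ 2) ?nnegrE ?mulr_ge0 ?norm2_ge0 //.
by rewrite exprMn !norm2_sqr real_normK ?num_real // cauchy_schwarz.
Qed.

End EuclideanSpace.

(** * The spectral norm bounds the quadratic form *)

Section SpectralNorm.
Variables (R : realType) (d : nat) (A : 'M[R]_d).

Lemma sqn_mulmx_le (x : 'cV[R]_d) :
  sqn (A *m x) <= (\sum_i sqn (row i A)^T) * sqn x.
Proof.
rewrite /sqn dotE mulr_suml ler_sum // => i _.
have -> : (A *m x) i 0 = dot (row i A)^T x.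
  by rewrite dotE mxE; apply: eq_bigr => j _; rewrite !mxE.
by rewrite -expr2 cauchy_schwarz.
Qed.

(** A supremum in [R] is only meaningful for a bounded set; the Frobenius norm
    is a bound. *)
Lemma spectral_norm_has_ubound :
  has_ubound
    [set norm2 (A *m x) | x in [set x : 'cV[R]_d | norm2 x <= 1]]%classic.
Proof.
exists (Num.sqrt (\sum_i sqn (row i A)^T)) => _ [x /= x1 <-].
apply: ler_wsqrtr; apply: le_trans (sqn_mulmx_le x) _.
rewrite ler_piMr ?sumr_ge0 // => [i _|]; first exact: sqn_ge0.
by rewrite -norm2_sqr expr_le1 ?norm2_ge0.
Qed.

Lemma spectral_norm_ge0 : 0 <= spectral_norm A.
Proof.
apply: le_trans (norm2_ge0 (A *m 0)) _; apply: ub_le_sup.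
  exact: spectral_norm_has_ubound.
exists 0 => //=; rewrite /norm2 -/(sqn _) sqn0 sqrtr0; exact: ler01.
Qed.

Lemma norm2_mulmx_le (x : 'cV[R]_d) :
  norm2 (A *m x) <= spectral_norm A * norm2 x.
Proof.
have [x0|x0] := eqVneq (norm2 x) 0.
  have -> : x = 0 by apply: sqn_eq0; rewrite -norm2_sqr x0 expr0n.
  by rewrite mulmx0 /norm2 -/(sqn _) sqn0 sqrtr0 mulr0.
have x1 : 0 < norm2 x by rewrite lt_neqAle eq_sym x0 norm2_ge0.
have norm2Z (k : R) (z : 'cV[R]_d) : 0 <= k -> norm2 (k *: z) = k * norm2 z.
  move=> k0; rewrite /norm2 -!/(sqn _) sqnZ sqrtrM ?sqr_ge0 //.
  by rewrite sqrtr_sqr ger0_norm.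
have : norm2 (A *m ((norm2 x)^-1 *: x)) <= spectral_norm A.
  apply: ub_le_sup; first exact: spectral_norm_has_ubound.
  exists ((norm2 x)^-1 *: x) => //=.
  by rewrite norm2Z ?invr_ge0 ?norm2_ge0 // mulVf.
rewrite -scalemxAr norm2Z ?invr_ge0 ?norm2_ge0 // => h.
by rewrite mulrC -ler_pdivrMl.
Qed.

Lemma dot_mulmx_le_spectral (x : 'cV[R]_d) :
  dot x (A *m x) <= spectral_norm A * sqn x.
Proof.
apply: le_trans (dot_le_norm2 _ _) _.
rewrite -norm2_sqr expr2 mulrCA.
by apply: ler_wpM2l; [exact: norm2_ge0|exact: norm2_mulmx_le].
Qed.

End SpectralNorm.

(** * Expansion in an orthonormal eigenbasis *)

Section Eigenbasis.
Variables (R : realType) (d : nat) (A : 'M[R]_d) (lam : 'I_d -> R).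
Variable u : 'I_d -> 'cV[R]_d.
Hypothesis A_sym : A^T = A.
Hypothesis u_eigen : orthonormal_eigenbasis A lam u.

(** A square matrix with orthonormal columns also has orthonormal rows, which is
    the completeness of the basis. *)
Lemma parseval (x : 'cV[R]_d) : sqn x = \sum_k dot (u k) x ^+ 2.
Proof.
have [_ u_on] := u_eigen.
pose U : 'M[R]_d := \matrix_(i, k) u k i 0.
have UtU : U^T *m U = 1%:M.
  apply/matrixP => j k; rewrite !mxE -u_on dotE.
  by apply: eq_bigr => i _; rewrite !mxE.
have Ux k : (U^T *m x) k 0 = dot (u k) x.
  by rewrite dotE mxE; apply: eq_bigr => i _; rewrite !mxE.
rewrite /sqn -{2}(mul1mx x) -(mulmx1C UtU) -mulmxA dot_mulmx dotE.
by apply: eq_bigr => k _; rewrite Ux expr2.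
Qed.

Lemma dot_eigen k (x : 'cV[R]_d) : dot (u k) (A *m x) = lam k * dot (u k) x.
Proof. by have [Au _] := u_eigen; rewrite dot_mulmx A_sym Au dotZl. Qed.

End Eigenbasis.

(** * The recurrence polynomials are squares of Chebyshev polynomials *)

Section ChebyshevRecurrence.
Variable R : realType.
Implicit Types a c be : R.

(** With [T_t] the Chebyshev polynomial of the first kind, this is
    [be^(t/2) T_t(a / sqrt be)]; it is the noiseless evolution of one
    eigencoordinate under the momentum iteration. *)
Fixpoint cheb (t : nat) a be {struct t} : R :=
  match t with
  | 0 => 1
  | t1.+1 => match t1 with
    | 0 => a
    | t2.+1 => 2 * a * cheb t1 a be - be * cheb t2 a be
    end
  end.

Lemma chebSS t a be :
  cheb t.+2 a be = 2 * a * cheb t.+1 a be - be * cheb t a be.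
Proof. by []. Qed.

(** The square of a solution of a second order linear recurrence satisfies a
    third order one, namely that of the statement. *)
Lemma rec_poly_cheb t a be :
  rec_poly t (4 * a ^+ 2) be = cheb t a be ^+ 2.
Proof.
have [] : [/\ rec_poly t (4 * a ^+ 2) be = cheb t a be ^+ 2,
  rec_poly t.+1 (4 * a ^+ 2) be = cheb t.+1 a be ^+ 2 &
  rec_poly t.+2 (4 * a ^+ 2) be = cheb t.+2 a be ^+ 2] => //.
elim: t => [|t [IH0 IH1 IH2]].
  by split; rewrite /= ?expr1n //; field.
split=> //.
rewrite [LHS]/= -/(rec_poly t.+2 _ _) -/(rec_poly t.+1 _ _) IH0 IH1 IH2.
rewrite !chebSS; ring.
Qed.

Lemma cheb_geom t a : cheb t a (a ^+ 2) = a ^+ t.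
Proof.
have [] : cheb t a (a ^+ 2) = a ^+ t /\ cheb t.+1 a (a ^+ 2) = a ^+ t.+1 => //.
elim: t => [|t [IH0 IH1]]; first by rewrite expr0 expr1.
by split=> //; rewrite chebSS IH0 IH1 !exprS; ring.
Qed.

(** The quadratic form attached to the characteristic polynomial
    [x^2 - 2 a x + be] is multiplied by [be] at each step. *)
Lemma cheb_invariant t a be :
  cheb t.+1 a be ^+ 2 - 2 * a * cheb t a be * cheb t.+1 a be
    + be * cheb t a be ^+ 2 = be ^+ t * (be - a ^+ 2).
Proof.
elim: t => [|t IH]; first by rewrite /=; ring.
by rewrite [in RHS]exprS -[RHS]mulrA -IH chebSS; ring.
Qed.

(** The analogue of [|T_t| <= 1] on [[-1, 1]]: the invariant bounds
    [(be - a^2) q_t^2] after completing the square in [q_(t+1)], and the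
    degenerate case [be = a^2] is geometric. *)
Lemma cheb_sqr_le t a be : a ^+ 2 <= be -> cheb t a be ^+ 2 <= be ^+ t.
Proof.
rewrite le_eqVlt => /orP[/eqP <-|ab]; first by rewrite cheb_geom exprAC.
have := cheb_invariant t a be.
set x := cheb t.+1 a be; set y := cheb t a be => inv.
rewrite -(@ler_pM2l _ (be - a ^+ 2)) ?subr_gt0 // [leRHS]mulrC -inv.
have := sqr_ge0 (x - a * y); lra.
Qed.

(** Above the critical value [sqrt be], each step multiplies by at least [a]:
    [a q_(t+1) <= q_(t+2)] follows from [be q_t <= a (a q_t) <= a q_(t+1)]. *)
Lemma cheb_ge t a be : 0 <= a -> be <= a ^+ 2 -> a ^+ t <= cheb t a be.
Proof.
move=> a0 bea.
have [] : a ^+ t <= cheb t a be /\ a * cheb t a be <= cheb t.+1 a be => //.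
elim: t => [|t [IH0 IH1]]; first by rewrite /= mulr1.
have q0 : 0 <= cheb t a be by apply: le_trans IH0; exact: exprn_ge0.
split; first by rewrite exprS; apply: le_trans IH1; exact: ler_wpM2l.
rewrite chebSS.
have := ler_wpM2l a0 IH1; have := ler_wpM2r q0 bea; lra.
Qed.

End ChebyshevRecurrence.

(** * Mean and variance of a mini-batch *)

Section Minibatches.
Variables (R : realType) (d n b : nat) (a : 'I_n -> 'cV[R]_d) (sch : sampling).
Hypothesis b_bounds : (0 < b <= n)%N.

Let MB := minibatches n sch b.

Lemma card_minibatches_gt0 : (0 < #|MB|)%N.
Proof.
case/andP: b_bounds => b0 bn; rewrite /MB; case: sch => /=.
  by rewrite cardsT card_tuple card_ord expn_gt0 (leq_trans b0 bn).
have := @card_uniq_tuples 'I_n b predT; rewrite card_ord => h.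
have -> : #|[set B : b.-tuple 'I_n | uniq B]%SET| = (n ^_ b)%N.
  by rewrite -h; apply: eq_card => t; rewrite !inE all_predT.
by rewrite ffact_gt0.
Qed.

Definition minibatch_weight (B : b.-tuple 'I_n) : R :=
  if B \in MB then #|MB|%:R^-1 else 0.

Lemma minibatch_weight_ge0 B : 0 <= minibatch_weight B.
Proof. by rewrite /minibatch_weight; case: ifP; rewrite ?invr_ge0. Qed.

Lemma sum_minibatch_weight : \sum_B minibatch_weight B = 1.
Proof.
rewrite -big_mkcond sumr_const -[LHS]mulr_natr mulVf // pnatr_eq0 -lt0n.
exact: card_minibatches_gt0.
Qed.

Lemma sum_weighted (V : lmodType R) (F : b.-tuple 'I_n -> V) :
  \sum_B minibatch_weight B *: F B = #|MB|%:R^-1 *: \sum_(B in MB) F B.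
Proof.
rewrite scaler_sumr [RHS]big_mkcond; apply: eq_bigr => B _.
by rewrite /minibatch_weight; case: ifP => // _; rewrite scale0r.
Qed.

Lemma map_perm_minibatch (s : {perm 'I_n}) (B : b.-tuple 'I_n) :
  (map_tuple s B \in MB) = (B \in MB).
Proof.
rewrite /MB; case: sch; rewrite !inE //=.
by rewrite map_inj_uniq //; exact: perm_inj.
Qed.

(** Both sampling schemes are invariant under relabelling the data, so a
    transposition of [l] and [l'] matches the mini-batches having [l] at place
    [i] with those having [l'] there: each index is equally likely at each
    place.  This treats the two schemes at once. *)
Lemma card_minibatches_at (i : 'I_b) (l : 'I_n) :
  (#|[set B in MB | tnth B i == l]%SET| * n)%N = #|MB|.
Proof.
have same l1 l2 : (#|[set B in MB | tnth B i == l1]%SET| <=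
    #|[set B in MB | tnth B i == l2]%SET|)%N.
  pose s := tperm l1 l2.
  have sK : involutive (fun B : b.-tuple 'I_n => map_tuple s B).
    by move=> B; apply: eq_from_tnth => j; rewrite !tnth_map tpermK.
  rewrite -(card_imset _ (inv_inj sK)); apply/subset_leq_card/fintype.subsetP.
  move=> B' /imsetP[B + ->]; rewrite !inE => /andP[BM /eqP Bl].
  by rewrite map_perm_minibatch BM tnth_map Bl tpermL eqxx.
have same_eq l1 : #|[set B in MB | tnth B i == l1]%SET| =
    #|[set B in MB | tnth B i == l]%SET|.
  by apply/eqP; rewrite eqn_leq !same.
rewrite -[RHS]sum1_card (partition_big (fun B => tnth B i) predT) //=.
rewrite (eq_bigr (fun=> #|[set B in MB | tnth B i == l]%SET|)) => [|l1 _].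
  by rewrite sum_nat_const card_ord mulnC.
by rewrite -(same_eq l1) -sum1dep_card.
Qed.

Lemma sum_minibatches (V : lmodType R) (f : 'I_n -> V) :
  \sum_(B in MB) \sum_(l <- B) f l = (#|MB|%:R * b%:R / n%:R) *: \sum_l f l.
Proof.
have n0 : (0 < n)%N by case/andP: b_bounds => b0; exact: leq_trans.
under eq_bigr do rewrite big_tuple.
rewrite exchange_big /=.
rewrite (eq_bigr (fun=> (#|MB|%:R / n%:R) *: \sum_l f l)) => [|i _].
  by rewrite sumr_const card_ord -scaler_nat scalerA mulrCA mulrA.
rewrite (partition_big (fun B => tnth B i) predT) //= scaler_sumr.
apply: eq_bigr => l _.
rewrite (eq_bigr (fun=> f l)) => [|B /andP[_ /eqP ->] //].
rewrite sumr_const -scaler_nat -(card_minibatches_at i l); congr (_ *: _).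
rewrite natrM mulfK ?pnatr_eq0 -?lt0n //; congr (_%:R).
by apply: eq_card => B; rewrite !inE.
Qed.

Lemma mean_batch_mx :
  \sum_B minibatch_weight B *: batch_mx a B = covariance_mx a.
Proof.
case/andP: (b_bounds) => b0 bn.
rewrite sum_weighted /batch_mx -scaler_sumr sum_minibatches !scalerA.
rewrite /covariance_mx; congr (_ *: _); field.
by rewrite !pnatr_eq0 -!lt0n card_minibatches_gt0 b0 (leq_trans b0 bn).
Qed.

Lemma trmx_covariance : (covariance_mx a)^T = covariance_mx a.
Proof.
rewrite /covariance_mx linearZ /= linear_sum /=; congr (_ *: _).
by apply: eq_bigr => i _; rewrite trmx_mul trmxK.
Qed.

Lemma trmx_batch_mx (B : b.-tuple 'I_n) : (batch_mx a B)^T = batch_mx a B.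
Proof.
rewrite /batch_mx linearZ /= linear_sum /=; congr (_ *: _).
by apply: eq_bigr => i _; rewrite trmx_mul trmxK.
Qed.

Lemma mean_batch_noise (v y : 'cV[R]_d) :
  \sum_B minibatch_weight B * dot v ((batch_mx a B - covariance_mx a) *m y) = 0.
Proof.
under eq_bigr do rewrite mulmxBl dotBr mulrBr -dotZr scalemxAl.
rewrite sumrB -mulr_suml sum_minibatch_weight mul1r.
by rewrite -dot_sumr -mulmx_suml mean_batch_mx subrr.
Qed.

(** Mini-batch matrices are symmetric, so the mean of the square norm is the
    quadratic form of the batch variance. *)
Lemma mean_batch_noise_sqn (y : 'cV[R]_d) :
  \sum_B minibatch_weight B * sqn ((batch_mx a B - covariance_mx a) *m y)
  <= variance_norm b a sch * sqn y.
Proof.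
apply: le_trans (dot_mulmx_le_spectral _ _).
rewrite /batch_variance -sum_weighted mulmx_suml dot_sumr ler_sum // => B _.
rewrite -scalemxAl dotZr -mulmxA dot_mulmx linearB /=.
by rewrite trmx_covariance trmx_batch_mx.
Qed.

(** A bound uniform in the mini-batch and in its size. *)
Lemma sqn_batch_mx_le (B : b.-tuple 'I_n) (y : 'cV[R]_d) :
  sqn (batch_mx a B *m y) <= (\sum_l sqn (a l) ^+ 2) * sqn y.
Proof.
have b0 : (0 < b%:R :> R) by rewrite ltr0n; case/andP: b_bounds.
have -> : batch_mx a B *m y = b%:R^-1 *: \sum_(l <- B) dot (a l) y *: a l.
  rewrite /batch_mx -scalemxAl mulmx_suml; congr (_ *: _).
  apply: eq_bigr => l _; rewrite -mulmxA; apply/matrixP => i j.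
  by rewrite ord1 !mxE big_ord1 mulrC.
rewrite sqnZ exprVn ler_pdivrMl ?exprn_gt0 //.
apply: le_trans (sqn_sum_le _ _) _; rewrite size_tuple expr2 -mulrA.
rewrite ler_pM2l // big_tuple [leRHS]mulr_natl.
rewrite -[X in _ <= _ *+ X]card_ord -sumr_const.
apply: ler_sum => i _; rewrite sqnZ.
apply: (@le_trans _ _ (sqn (a (tnth B i)) ^+ 2 * sqn y)).
  rewrite [X in _ <= X * _]expr2 [leRHS]mulrAC.
  by apply: ler_wpM2r; [exact: sqn_ge0|exact: cauchy_schwarz].
apply: ler_wpM2r; first exact: sqn_ge0.
by rewrite (bigD1 (tnth B i)) //= lerDl sumr_ge0 // => j _; exact: sqr_ge0.
Qed.

End Minibatches.

(** * Finite product measures *)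

Section ProductExpectation.
Variables (R : realType) (X : finType) (I : finType) (J : eqType).
Variables (key : I -> J) (x0 : X) (mu : X -> R).
Hypothesis key_inj : injective key.
Hypothesis mu_ge0 : forall x, 0 <= mu x.
Hypothesis mu_sum : \sum_x mu x = 1.
Implicit Types (tau : {ffun I -> X}) (F G : (J -> X) -> R).

(** Random variables are functions of a total family indexed by [J], of which
    only the coordinates in the image of [key] are sampled; the others take the
    default value [x0]. *)
Definition env tau (j : J) : X :=
  if [pick i | key i == j] is Some i then tau i else x0.

Lemma env_key tau i : env tau (key i) = tau i.
Proof.
rewrite /env; case: pickP => [i' /eqP /key_inj -> //|/(_ i)].
by rewrite eqxx.
Qed.

Definition weight tau : R := \prod_i mu (tau i).

Definition expect G : R := \sum_tau weight tau * G (env tau).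

Lemma weight_ge0 tau : 0 <= weight tau.
Proof. by apply: prodr_ge0 => i _. Qed.

Lemma expect_cst r : expect (fun=> r) = r.
Proof.
rewrite /expect -mulr_suml /weight -(bigA_distr_bigA (fun=> mu)).
by rewrite big1 ?mul1r // => i _; rewrite mu_sum.
Qed.

Lemma expectD F G : expect (fun s => F s + G s) = expect F + expect G.
Proof. by rewrite -big_split; apply: eq_bigr => tau _; rewrite mulrDr. Qed.

Lemma expectZ r G : expect (fun s => r * G s) = r * expect G.
Proof. by rewrite mulr_sumr; apply: eq_bigr => tau _; rewrite mulrCA. Qed.

Lemma expect_sum (K : finType) (A : pred K) (G : K -> (J -> X) -> R) :
  expect (fun s => \sum_(k | A k) G k s) = \sum_(k | A k) expect (G k).
Proof.
by rewrite exchange_big; apply: eq_bigr => tau _; rewrite mulr_sumr.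
Qed.

Lemma le_expect F G : (forall s, F s <= G s) -> expect F <= expect G.
Proof.
by move=> FG; apply: ler_sum => tau _; apply: ler_wpM2l; rewrite ?weight_ge0.
Qed.

Lemma eq_expect F G : (forall s, F s = G s) -> expect F = expect G.
Proof. by move=> FG; apply: eq_bigr => tau _; rewrite FG. Qed.

(** Fubini for the coordinate [key i], in the form of an exchangeability: the
    pair made of a sample and an independent copy [x] of its coordinate [i] has
    the same law after exchanging [x] with that coordinate. *)
Lemma expect_resample (i : I) (H : (J -> X) -> X -> R) :
  (forall s s', (forall j, j != key i -> s j = s' j) -> H s =1 H s') ->
  expect (fun s => H s (s (key i))) = expect (fun s => \sum_x mu x * H s x).
Proof.
move=> H_indep.
pose set_at tau x : {ffun I -> X} := [ffun k => if k == i then x else tau k].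
pose swap (p : {ffun I -> X} * X) := (set_at p.1 p.2, p.1 i).
have swapK : involutive swap.
  move=> [tau x]; rewrite /swap /= ffunE eqxx; congr (_, _).
  by apply/ffunP => k; rewrite !ffunE; case: eqP => // ->.
have weight_swap tau x :
    weight (set_at tau x) * mu (tau i) = weight tau * mu x.
  rewrite /weight (bigD1 i) //= [in RHS](bigD1 i) //= ffunE eqxx.
  rewrite mulrAC [RHS]mulrAC [mu x * _]mulrC; congr (_ * _ * _).
  by apply: eq_bigr => k /negbTE ki; rewrite ffunE ki.
transitivity (\sum_(p : {ffun I -> X} * X)
    weight p.1 * mu p.2 * H (env p.1) (p.1 i)).
  rewrite -(pair_bigA _ (fun tau x => weight tau * mu x * H (env tau) (tau i))).
  apply: eq_bigr => tau _; rewrite env_key.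
  by rewrite -mulr_suml -mulr_sumr mu_sum mulr1.
rewrite (reindex_inj (inv_inj swapK)) /=.
rewrite -(pair_bigA _ (fun tau x =>
  weight (set_at tau x) * mu (tau i) *
  H (env (set_at tau x)) (set_at tau x i))).
apply: eq_bigr => tau _; rewrite mulr_sumr; apply: eq_bigr => x _ /=.
rewrite weight_swap ffunE eqxx mulrA; congr (_ * _).
apply: H_indep => j ji; rewrite /env; case: pickP => // k /eqP kj.
by rewrite ffunE; case: eqP => // ki; rewrite -kj ki eqxx in ji.
Qed.

End ProductExpectation.

(** * Independent finite-valued variables follow the product measure *)

Section LawOfSamples.
Local Open Scope classical_set_scope.
Variables (R : realType) (disp : measure_display) (T : measurableType disp).
Variables (P : probability T R) (X I : finType) (J : eqType).
Variables (key : I -> J) (x0 : X) (mu : X -> R) (S : J -> T -> X).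
Hypothesis key_inj : injective key.
Hypothesis S_meas : forall i x, measurable (S (key i) @^-1` [set x]%classic).
Hypothesis S_law : forall i x, P (S (key i) @^-1` [set x]%classic) = (mu x)%:E.
Hypothesis S_indep : forall A : J -> set X,
  P (\bigcap_(i in [set: I]) (S (key i) @^-1` A (key i)))%classic =
  (\prod_i P (S (key i) @^-1` A (key i)))%E.

(** [G] is a finite combination of indicators of cylinders, one for each tuple
    of values of the samples, and independence gives their probabilities.
    Nonnegativity of [G] makes the integral of the sum split by measurability
    alone. *)
Lemma expectation_samples (G : (J -> X) -> R) :
  (forall s, 0 <= G s) ->
  (forall s s', (forall i, s (key i) = s' (key i)) -> G s = G s') ->
  ('E_P[(fun t => G (fun j => S j t))] = (expect key x0 mu G)%:E)%E.
Proof.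
move=> G0 G_dep.
pose cyl (tau : {ffun I -> X}) : set T :=
  (\bigcap_(i in [set: I]) (S (key i) @^-1` [set tau i]))%classic.
have cyl_meas tau : measurable (cyl tau).
  by apply: fin_bigcap_measurable => // i _; exact: S_meas.
have cyl_weight tau : P (cyl tau) = (weight mu tau)%:E.
  rewrite /cyl -(eq_bigcapr (F := fun i =>
    S (key i) @^-1` [set env key x0 tau (key i)]%classic)) => [|i _].
    rewrite (S_indep (fun j => [set env key x0 tau j]%classic)) /weight.
    rewrite -prodEFin; apply: eq_bigr => i _.
    by rewrite S_law env_key.
  by rewrite env_key.
have decomp t : G (fun j => S j t) =
    \sum_(tau : {ffun I -> X}) G (env key x0 tau) * \1_(cyl tau) t.
  pose tau0 : {ffun I -> X} := [ffun i => S (key i) t].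
  rewrite (bigD1 tau0) //= big1 ?addr0 => [|tau tau_neq].
    rewrite indicE mem_set ?mulr1 => [|i _ /=]; last by rewrite ffunE.
    by apply: G_dep => i; rewrite env_key // ffunE.
  rewrite indicE memNset ?mulr0 // => tP; case/eqP: tau_neq.
  by apply/ffunP => i; rewrite ffunE; apply/esym; exact: tP.
rewrite unlock.
under eq_integral do rewrite decomp -sumEFin.
rewrite ge0_integral_sum //; last 2 first.
- by move=> tau; apply/measurable_EFinP; apply: measurable_funM.
- by move=> tau t _; rewrite lee_fin mulr_ge0.
rewrite /expect -sumEFin; apply: eq_bigr => tau _.
under eq_integral do rewrite EFinM.
rewrite ge0_integralZl_EFin //; last first.
  by apply/measurable_EFinP; exact: measurable_indic.
by rewrite integral_indic // setIT [X in (_ * X)%E]cyl_weight -EFinM mulrC.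
Qed.

End LawOfSamples.

(** * Projection away from the start of an epoch *)

Section ProjectionResidual.
Variables (R : realType) (d : nat) (w0 : 'cV[R]_d).
Implicit Types x y : 'cV[R]_d.

Definition resid x : 'cV[R]_d := x - proj_coef w0 x *: w0.

Lemma proj_coefE x : proj_coef w0 x = dot x w0 / sqn w0.
Proof. by rewrite /proj_coef norm2_sqr. Qed.

Lemma residD x y : resid (x + y) = resid x + resid y.
Proof.
by rewrite /resid !proj_coefE dotDl mulrDl scalerDl opprD addrACA.
Qed.

Lemma residZ k x : resid (k *: x) = k *: resid x.
Proof. by rewrite /resid !proj_coefE dotZl -mulrA scalerBr scalerA. Qed.

Lemma residN x : resid (- x) = - resid x.
Proof. by rewrite -scaleN1r residZ scaleN1r. Qed.

Lemma resid_self : resid w0 = 0.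
Proof.
rewrite /resid proj_coefE; have [z|nz] := eqVneq (sqn w0) 0.
  by rewrite (sqn_eq0 z) scaler0 subr0.
by rewrite divff // scale1r subrr.
Qed.

Lemma pythagoras_resid x :
  sqn x = sqn (resid x) + proj_coef w0 x ^+ 2 * sqn w0.
Proof.
have [z|nz] := eqVneq (sqn w0) 0.
  by rewrite /resid z mulr0 (sqn_eq0 z) scaler0 subr0 addr0.
rewrite /resid proj_coefE {2}/sqn dotBl !dotBr !dotZl !dotZr (dotC w0 x).
by rewrite -!/(sqn _); field.
Qed.

Lemma sqn_resid_le x : sqn (resid x) <= sqn x.
Proof. by rewrite [leRHS]pythagoras_resid lerDl mulr_ge0 ?sqr_ge0 ?sqn_ge0. Qed.

(** Holds also for [w0 = 0], where the coefficient is [0]. *)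
Lemma proj_coef_sqr_le x c :
  0 <= c -> sqn x <= c * sqn w0 -> proj_coef w0 x ^+ 2 <= c.
Proof.
move=> c0 xc; have [z|nz] := eqVneq (sqn w0) 0.
  by rewrite proj_coefE z invr0 mulr0 expr0n.
have w1 : 0 < sqn w0 by rewrite lt_neqAle eq_sym nz sqn_ge0.
rewrite -(ler_pM2r w1); apply: le_trans xc.
by rewrite [leRHS]pythagoras_resid lerDr sqn_ge0.
Qed.

End ProjectionResidual.

Lemma exprSM (R : realType) (x y : R) t : x ^+ t.+1 * y = x * (x ^+ t * y).
Proof. by rewrite exprS mulrA. Qed.

Section SumsOfVectors.
Variables (R : realType) (d : nat).
Implicit Types x y z t : 'cV[R]_d.

Lemma sqnD4_le x y z t :
  sqn (x + y + z + t) <= 4 * (sqn x + sqn y + sqn z + sqn t).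
Proof.
rewrite -addrA; have := sqnD_le (x + y) (z + t).
have := sqnD_le x y; have := sqnD_le z t; lra.
Qed.

Lemma sqnD3_le x y z : sqn (x + y + z) <= 4 * (sqn x + sqn y + sqn z).
Proof. by have := sqnD4_le x y z 0; rewrite sqn0 !addr0. Qed.

End SumsOfVectors.

(** The mini-batch of inner iteration [t + 1] of epoch [e]; inner iteration [0]
    draws none, hence the shift. *)
Definition sample_key (s m : nat) (i : 'I_s * 'I_m.-1) : nat * nat :=
  (val i.1, (val i.2).+1).

Lemma sample_key_inj s m : injective (@sample_key s m).
Proof.
move=> [e t] [e' t'] [/= ee' tt'].
by congr (_, _); apply: val_inj.
Qed.

(** * One epoch for fixed mini-batches *)

Section Epoch.
Variables (R : realType) (d n b : nat) (a : 'I_n -> 'cV[R]_d.+2).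
Variables (lam : 'I_d.+2 -> R) (u : 'I_d.+2 -> 'cV[R]_d.+2) (eta : R).
Hypothesis u_eigen : orthonormal_eigenbasis (covariance_mx a) lam u.
Hypothesis lam_gap : lam 1 < lam 0.
Hypothesis lam_sorted : forall j k : 'I_d.+2, (0 < j <= k)%N -> lam k <= lam j.
Hypothesis lam_ge0 : forall k : 'I_d.+2, 0 <= lam k.
Hypothesis b_bounds : (0 < b <= n)%N.
Hypothesis eta_bounds : 0 < eta <= 1.

Let C := covariance_mx a.
Let be := beta_par eta (lam 1).

Definition tail (w : 'cV[R]_d.+2) : R :=
  \sum_(k < d.+2 | k != 0) dot (u k) w ^+ 2.

(** A common bound for the squared norms of all the linear maps in one step,
    uniform in [eta], in the mini-batch and in its size: the three terms take
    care of constants, of mini-batch matrices, and of spectral quantities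
    including [beta^2]. *)
Definition step_bound : R := 1 + \sum_l sqn (a l) ^+ 2 + (1 + lam 0) ^+ 4.

(** The constant is [16 + 16 + 16 + 4], the total weight of the four terms of
    a step when the square of the sum is bounded by four times the sum of the
    squares. *)
Definition growth : R := 52 * step_bound.

Let M := step_bound.

Lemma tail_ge0 w : 0 <= tail w.
Proof. by apply: sumr_ge0 => k _; exact: sqr_ge0. Qed.

Lemma tail_parseval w : sqn w = dot (u 0) w ^+ 2 + tail w.
Proof. by rewrite (parseval u_eigen) (bigD1 0). Qed.

Lemma lam_le1 k : k != 0 -> lam k <= lam 1.
Proof. by move=> k0; apply: lam_sorted; rewrite /= lt0n. Qed.

Lemma lam_le0 k : lam k <= lam 0.
Proof.
have [->//|k0] := eqVneq k 0.
by apply: le_trans (lam_le1 k0) _; exact: ltW.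
Qed.

(** The eigenvalue of [(1 - eta) I + eta C] for the eigenvalue [l] of [C]. *)
Definition damped (l : R) : R := 1 - eta + eta * l.

Lemma damped_ge0 k : 0 <= damped (lam k).
Proof.
rewrite /damped; have := lam_ge0 k; case/andP: eta_bounds => e0 e1 l0.
by have := mulr_ge0 (ltW e0) l0; lra.
Qed.

Lemma damped_le k : damped (lam k) <= 1 + lam 0.
Proof.
rewrite /damped; have := lam_ge0 k; have := lam_le0 k.
case/andP: eta_bounds => e0 e1 l1 l0.
by have := ler_wpM2r l0 e1; lra.
Qed.

Lemma data_bound_ge0 : 0 <= \sum_l sqn (a l) ^+ 2.
Proof. by apply: sumr_ge0 => l _; exact: sqr_ge0. Qed.

Lemma step_bound_ge1 : 1 <= M.
Proof.
rewrite /M /step_bound -addrA lerDl addr_ge0 ?data_bound_ge0 //.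
by rewrite exprn_ge0 // addr_ge0.
Qed.

Lemma sqr_le_step_bound x : 0 <= x <= 1 + lam 0 -> x ^+ 2 <= M.
Proof.
case/andP=> x0 x1; apply: (@le_trans _ _ ((1 + lam 0) ^+ 4)); last first.
  by rewrite /M /step_bound lerDr addr_ge0 ?data_bound_ge0.
apply: (@le_trans _ _ ((1 + lam 0) ^+ 2)).
  by rewrite ler_pXn2r ?nnegrE // addr_ge0.
by rewrite ler_weXn2l // lerDl.
Qed.

Lemma damped_sqr_le k : damped (lam k) ^+ 2 <= M.
Proof. by apply: sqr_le_step_bound; rewrite damped_ge0 damped_le. Qed.

Lemma lam0_sqr_le : lam 0 ^+ 2 <= M.
Proof. by apply: sqr_le_step_bound; rewrite lam_ge0 lerDr ler01. Qed.

Lemma beta_sqr_le : be ^+ 2 <= M.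
Proof.
rewrite /be /beta_par -/(damped _) -exprM.
apply: (@le_trans _ _ ((1 + lam 0) ^+ 4)); last first.
  by rewrite /M /step_bound lerDr addr_ge0 ?data_bound_ge0.
by rewrite ler_pXn2r ?nnegrE ?damped_le ?damped_ge0 // addr_ge0.
Qed.

Lemma sqn_batch_step (B : b.-tuple 'I_n) y :
  sqn (batch_mx a B *m y) <= M * sqn y.
Proof.
apply: le_trans (sqn_batch_mx_le _ b_bounds _ _) _.
apply: ler_wpM2r; first exact: sqn_ge0.
rewrite /M /step_bound addrAC lerDr addr_ge0 // exprn_ge0 // addr_ge0 //.
Qed.

Lemma sqn_spectral_le (f : 'I_d.+2 -> R) (c : R) (x y : 'cV[R]_d.+2) :
  (forall k, dot (u k) x = f k * dot (u k) y) -> (forall k, f k ^+ 2 <= c) ->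
  sqn x <= c * sqn y.
Proof.
move=> fk fc; rewrite !(parseval u_eigen) mulr_sumr ler_sum // => k _.
by rewrite fk exprMn ler_wpM2r ?sqr_ge0.
Qed.

Lemma dot_cov k x : dot (u k) (C *m x) = lam k * dot (u k) x.
Proof. exact: dot_eigen (trmx_covariance a) u_eigen k x. Qed.

Lemma sqn_cov_le x : sqn (C *m x) <= M * sqn x.
Proof.
apply: sqn_spectral_le (dot_cov^~ x) _ => k.
by apply: sqr_le_step_bound; rewrite lam_ge0 /=; have := lam_le0 k; lra.
Qed.

Lemma dot_damped_cov k x :
  dot (u k) ((1 - eta) *: x + eta *: (C *m x)) = damped (lam k) * dot (u k) x.
Proof. by rewrite dotDr !dotZr dot_cov /damped; ring. Qed.

Lemma sqn_damped_cov_le x : sqn ((1 - eta) *: x + eta *: (C *m x)) <= M * sqn x.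
Proof. exact: sqn_spectral_le (dot_damped_cov^~ x) damped_sqr_le. Qed.

(** Source of the factor [tail w0] in all residual bounds: subtracting
    [lam 0 *: w0] does not change the residual and kills the leading coordinate
    of [C *m w0]. *)
Lemma sqn_resid_cov_le w0 : sqn (resid w0 (C *m w0)) <= M * tail w0.
Proof.
have -> : resid w0 (C *m w0) = resid w0 (C *m w0 - lam 0 *: w0).
  by rewrite residD residN residZ resid_self scaler0 subr0.
apply: le_trans (sqn_resid_le _ _) _.
rewrite tail_parseval dotBr dotZr dot_cov subrr expr0n add0r mulr_sumr.
apply: ler_sum => k _; rewrite dotBr dotZr dot_cov -mulrBl exprMn.
rewrite ler_wpM2r ?sqr_ge0 //; apply: le_trans lam0_sqr_le.
rewrite -[leLHS]sqrrN opprB ler_pXn2r ?nnegrE ?subr_ge0 ?lam_le0 //.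
by rewrite gerBl.
Qed.

Lemma inner_iterSS w0 (S : nat -> b.-tuple 'I_n) t :
  inner_iter a eta be w0 S t.+2 =
  2 *: ((1 - eta) *: inner_iter a eta be w0 S t.+1
        + eta *: vr_gradient a w0 (S t.+1) (inner_iter a eta be w0 S t.+1))
  - be *: inner_iter a eta be w0 S t.
Proof. by []. Qed.

Section Iterates.
Variables (w0 : 'cV[R]_d.+2) (S : nat -> b.-tuple 'I_n).

Definition iterate t := inner_iter a eta be w0 S t.
Definition iter_resid t := resid w0 (iterate t).

(** On the component along [w0] the gradient is exact, so the mini-batch only
    acts on the residual. *)
Lemma iterateSS t : iterate t.+2 =
  (2 * (1 - eta)) *: iterate t.+1 +
  (2 * eta) *: (batch_mx a (S t.+1) *m iter_resid t.+1) +
  (2 * eta * proj_coef w0 (iterate t.+1)) *: (C *m w0) + (- be) *: iterate t.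
Proof.
rewrite [LHS]/iterate inner_iterSS -/(iterate t.+1) -/(iterate t).
rewrite /vr_gradient -/(resid w0 _).
by rewrite -/(iter_resid _) !scalerDr !scalerA scaleNr !addrA mulrA.
Qed.

Lemma iter_residSS t : iter_resid t.+2 =
  (2 * (1 - eta)) *: iter_resid t.+1 +
  (2 * eta) *: resid w0 (batch_mx a (S t.+1) *m iter_resid t.+1) +
  (2 * eta * proj_coef w0 (iterate t.+1)) *: resid w0 (C *m w0) +
  (- be) *: iter_resid t.
Proof. by rewrite /iter_resid iterateSS !residD !residZ. Qed.

Lemma growth_ge1 : 1 <= growth.
Proof. by have := step_bound_ge1; rewrite /growth -/M; lra. Qed.

Lemma eta_sqr_le1 : eta ^+ 2 <= 1 /\ (1 - eta) ^+ 2 <= 1.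
Proof. by case/andP: eta_bounds => e0 e1; split; nra. Qed.

(** The induction step common to the geometric bounds below: [x1], [x2], [x3]
    come from the last iterate and [x4] from the one before. *)
Lemma growth_step (x1 x2 x3 x4 Q q : R) :
  0 <= Q -> q <= Q -> x1 <= 4 * (growth * Q) -> x2 <= 4 * M * (growth * Q) ->
  x3 <= 4 * M * (growth * Q) -> x4 <= M * q ->
  4 * (x1 + x2 + x3 + x4) <= growth * (growth * Q).
Proof.
move=> Q0 qQ h1 h2 h3 h4.
have M1 := step_bound_ge1; have k1 := growth_ge1.
have kQ : 0 <= growth * Q by rewrite mulr_ge0 //; lra.
have h5 : M * q <= M * (growth * Q).
  by rewrite ler_wpM2l //; first lra; apply: le_trans qQ _; rewrite ler_peMl.
have h6 : growth * Q <= M * (growth * Q) by rewrite ler_peMl.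
rewrite {1}/growth -/M -mulrA; lra.
Qed.

Lemma sqn_iter_le t : sqn (iterate t) <= growth ^+ t * sqn w0.
Proof.
have [e1 e2] := eta_sqr_le1.
have k0 : 0 <= growth by apply: le_trans ler01 growth_ge1.
have M0 : 0 <= M by apply: le_trans ler01 step_bound_ge1.
have [] : sqn (iterate t) <= growth ^+ t * sqn w0 /\
    sqn (iterate t.+1) <= growth ^+ t.+1 * sqn w0 => //.
elim: t => [|t [IH0 IH1]].
  split; first by rewrite mul1r.
  rewrite expr1; apply: le_trans (sqn_damped_cov_le _) _.
  rewrite ler_wpM2r ?sqn_ge0 // /growth.
  by have := step_bound_ge1; rewrite -/M; lra.
split=> //; rewrite iterateSS; apply: le_trans (sqnD4_le _ _ _ _) _.
rewrite 2!exprSM.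
rewrite exprSM in IH1.
set Q := growth ^+ t * sqn w0 in IH0 IH1 *.
have Q0 : 0 <= Q by rewrite mulr_ge0 ?exprn_ge0 ?sqn_ge0.
have kQ : 0 <= growth * Q by rewrite mulr_ge0.
apply: (growth_step Q0 IH0).
- rewrite sqnZ; have := sqn_ge0 (iterate t.+1); nra.
- rewrite sqnZ exprMn.
  have := sqn_batch_step (S t.+1) (iter_resid t.+1).
  have h := le_trans (sqn_resid_le w0 (iterate t.+1)) IH1.
  have := ler_wpM2l M0 h.
  have := sqn_ge0 (batch_mx a (S t.+1) *m iter_resid t.+1).
  rewrite /iter_resid; nra.
- rewrite sqnZ 2!exprMn.
  have p : proj_coef w0 (iterate t.+1) ^+ 2 <= growth ^+ t.+1.
    by apply: proj_coef_sqr_le; rewrite ?exprn_ge0 // exprSM.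
  have h := ler_pM (sqr_ge0 _) (sqn_ge0 _) p (sqn_cov_le w0).
  have -> : 4 * M * (growth * Q) = 4 * 1 * (growth ^+ t.+1 * (M * sqn w0)).
    by rewrite /Q (exprS growth); ring.
  rewrite -(mulrA (2 ^+ 2 * eta ^+ 2)); apply: ler_pM => //.
  + by rewrite mulr_ge0 ?sqr_ge0.
  + by rewrite mulr_ge0 ?sqr_ge0 ?sqn_ge0.
  + by rewrite (_ : 2 ^+ 2 = 4) ?ler_wpM2l // -natrX.
- by rewrite sqnZ sqrrN; apply: ler_wpM2r; rewrite ?sqn_ge0 ?beta_sqr_le.
Qed.

(** The residual starts at [0], gets [eta *: resid w0 (C *m w0)] at the first
    step, and is afterwards driven by multiples of itself and of that vector;
    the coefficients [proj_coef w0 (iterate t)] are controlled by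
    [sqn_iter_le]. *)
Lemma sqn_iter_resid_le t :
  sqn (iter_resid t) <= growth ^+ t * (eta ^+ 2 * tail w0).
Proof.
have [e1 e2] := eta_sqr_le1.
have k0 : 0 <= growth by apply: le_trans ler01 growth_ge1.
have M0 : 0 <= M by apply: le_trans ler01 step_bound_ge1.
have T0 : 0 <= eta ^+ 2 * tail w0 by rewrite mulr_ge0 ?sqr_ge0 ?tail_ge0.
have [] : sqn (iter_resid t) <= growth ^+ t * (eta ^+ 2 * tail w0) /\
    sqn (iter_resid t.+1) <= growth ^+ t.+1 * (eta ^+ 2 * tail w0) => //.
elim: t => [|t [IH0 IH1]].
  rewrite /iter_resid /iterate /= resid_self sqn0 mul1r; split=> //.
  rewrite residD !residZ resid_self scaler0 add0r sqnZ expr1 mulrCA.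
  rewrite ler_wpM2l ?sqr_ge0 //; apply: le_trans (sqn_resid_cov_le _) _.
  rewrite ler_wpM2r ?tail_ge0 // /growth.
  by have := step_bound_ge1; rewrite -/M; lra.
split=> //; rewrite iter_residSS; apply: le_trans (sqnD4_le _ _ _ _) _.
rewrite 2!exprSM.
rewrite exprSM in IH1.
set Q := growth ^+ t * (eta ^+ 2 * tail w0) in IH0 IH1 *.
have Q0 : 0 <= Q by rewrite mulr_ge0 ?exprn_ge0.
have kQ : 0 <= growth * Q by rewrite mulr_ge0.
apply: (growth_step Q0 IH0).
- rewrite sqnZ; have := sqn_ge0 (iter_resid t.+1); nra.
- rewrite sqnZ exprMn.
  have h1 := sqn_batch_step (S t.+1) (iter_resid t.+1).
  have := le_trans (sqn_resid_le w0 _) h1.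
  have := ler_wpM2l M0 IH1.
  have := sqn_ge0 (resid w0 (batch_mx a (S t.+1) *m iter_resid t.+1)).
  nra.
- rewrite sqnZ 2!exprMn.
  have p : proj_coef w0 (iterate t.+1) ^+ 2 <= growth ^+ t.+1.
    by apply: proj_coef_sqr_le; rewrite ?exprn_ge0 // sqn_iter_le.
  have h := ler_pM (sqr_ge0 _) (sqn_ge0 _) p (sqn_resid_cov_le w0).
  have -> : 4 * M * (growth * Q) =
      4 * eta ^+ 2 * (growth ^+ t.+1 * (M * tail w0)).
    by rewrite /Q (exprS growth); ring.
  rewrite -(mulrA (2 ^+ 2 * eta ^+ 2)); apply: ler_pM => //.
  + by rewrite mulr_ge0 ?sqr_ge0.
  + by rewrite mulr_ge0 ?sqr_ge0 ?sqn_ge0.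
  + by rewrite (_ : 2 ^+ 2 = 4) // -natrX.
- by rewrite sqnZ sqrrN; apply: ler_wpM2r; rewrite ?sqn_ge0 ?beta_sqr_le.
Qed.

(** The iteration with [C] in place of the mini-batch matrices; it is the
    conditional mean of [iterate] given [w0]. *)
Fixpoint mean_iter (t : nat) {struct t} : 'cV[R]_d.+2 :=
  match t with
  | 0 => w0
  | t1.+1 => match t1 with
    | 0 => (1 - eta) *: w0 + eta *: (C *m w0)
    | t2.+1 => 2 *: ((1 - eta) *: mean_iter t1 + eta *: (C *m mean_iter t1))
               - be *: mean_iter t2
    end
  end.

Lemma mean_iterSS t : mean_iter t.+2 =
  2 *: ((1 - eta) *: mean_iter t.+1 + eta *: (C *m mean_iter t.+1))
  - be *: mean_iter t.
Proof. by []. Qed.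

Lemma dot_mean_iter k t :
  dot (u k) (mean_iter t) = cheb t (damped (lam k)) be * dot (u k) w0.
Proof.
have [] : dot (u k) (mean_iter t) = cheb t (damped (lam k)) be * dot (u k) w0 /\
  dot (u k) (mean_iter t.+1) = cheb t.+1 (damped (lam k)) be * dot (u k) w0 => //.
elim: t => [|t [IH0 IH1]].
  by rewrite mul1r; split=> //; exact: dot_damped_cov.
split=> //; rewrite mean_iterSS chebSS.
by rewrite dotBr !dotZr dot_damped_cov IH0 IH1; ring.
Qed.

Definition iter_err t := iterate t - mean_iter t.
Definition iter_noise t := (batch_mx a (S t) - C) *m iter_resid t.

Lemma iter_errSS t : iter_err t.+2 =
  2 *: ((1 - eta) *: iter_err t.+1 + eta *: (C *m iter_err t.+1))
  + (2 * eta) *: iter_noise t.+1 + (- be) *: iter_err t.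
Proof.
have split_iter : C *m iterate t.+1 =
    C *m iter_resid t.+1 + proj_coef w0 (iterate t.+1) *: (C *m w0).
  by rewrite scalemxAr -mulmxDr /iter_resid /resid subrK.
rewrite /iter_err /iter_noise iterateSS mean_iterSS.
rewrite (mulmxBr C (iterate t.+1)) (mulmxBl _ C) split_iter.
by apply/matrixP => i j; rewrite !mxE; ring.
Qed.

Lemma iter_err0 : iter_err 0 = 0. Proof. exact: subrr. Qed.
Lemma iter_err1 : iter_err 1 = 0. Proof. exact: subrr. Qed.

Lemma dot_iter_errSS k t : dot (u k) (iter_err t.+2) =
  2 * damped (lam k) * dot (u k) (iter_err t.+1)
  + 2 * eta * dot (u k) (iter_noise t.+1) - be * dot (u k) (iter_err t).
Proof.
rewrite iter_errSS dotDr [dot _ (_ + _ *: iter_noise _)]dotDr 3!dotZr.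
by rewrite dot_damped_cov; ring.
Qed.

Lemma sqn_iter_errSS t : sqn (iter_err t.+2) <=
  4 * (4 * M * sqn (iter_err t.+1) + 4 * eta ^+ 2 * sqn (iter_noise t.+1)
       + M * sqn (iter_err t)).
Proof.
rewrite iter_errSS; apply: le_trans (sqnD3_le _ _ _) _.
rewrite ler_wpM2l // !sqnZ sqrrN exprMn (_ : 2 ^+ 2 = 4) -?natrX //.
apply: lerD; last by rewrite ler_wpM2r ?sqn_ge0 ?beta_sqr_le.
apply: lerD => //.
by rewrite -mulrA ler_wpM2l // sqn_damped_cov_le.
Qed.

End Iterates.

Lemma inner_iter_ext w0 (S S' : nat -> b.-tuple 'I_n) t :
  (forall t', (0 < t' < t)%N -> S t' = S' t') ->
  inner_iter a eta be w0 S t = inner_iter a eta be w0 S' t.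
Proof.
have [] : ((forall t', (0 < t' < t)%N -> S t' = S' t') ->
    inner_iter a eta be w0 S t = inner_iter a eta be w0 S' t) /\
  ((forall t', (0 < t' < t.+1)%N -> S t' = S' t') ->
    inner_iter a eta be w0 S t.+1 = inner_iter a eta be w0 S' t.+1) => //.
elim: t => [//|t [IH0 IH1]]; split=> // SS'.
have h1 : forall t', (0 < t' < t.+1)%N -> S t' = S' t'.
  by move=> t' /andP[p q]; apply: SS'; rewrite p ltnW.
have h0 : forall t', (0 < t' < t)%N -> S t' = S' t'.
  by move=> t' /andP[p q]; apply: h1; rewrite p ltnW.
by rewrite !inner_iterSS (IH0 h0) (IH1 h1) (SS' t.+1) // ltnSn.
Qed.

Lemma vr_hb_power_ext m w0 (S S' : nat -> nat -> b.-tuple 'I_n) s :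
  (forall e t, (e < s)%N -> (0 < t < m)%N -> S e t = S' e t) ->
  vr_hb_power a eta be m w0 S s = vr_hb_power a eta be m w0 S' s.
Proof.
elim: s => [//|s IH] SS' /=; rewrite IH => [|e t es]; last first.
  by apply: SS'; exact: ltnW.
by apply: inner_iter_ext => t; exact: SS'.
Qed.


(** * Expectations over the epochs *)

Section Expectations.
Variables (m s : nat) (w0 : 'cV[R]_d.+2) (B0 : b.-tuple 'I_n) (sch : sampling).

Let mu := minibatch_weight R sch : b.-tuple 'I_n -> R.
Let K := variance_norm b a sch.
Let E := expect (@sample_key s m) B0 mu.
Let mu_ge0 : forall B, 0 <= mu B := minibatch_weight_ge0 R sch.
Let mu_sum : \sum_B mu B = 1 := sum_minibatch_weight R sch b_bounds.

Let E_cst r : E (fun=> r) = r.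
Proof. exact: expect_cst. Qed.

Let E_D F G : E (fun sig => F sig + G sig) = E F + E G.
Proof. exact: expectD. Qed.

Let E_Z r G : E (fun sig => r * G sig) = r * E G.
Proof. exact: expectZ. Qed.

Let E_sum (A : pred 'I_d.+2) G :
  E (fun sig => \sum_(k | A k) G k sig) = \sum_(k | A k) E (G k).
Proof. exact: expect_sum. Qed.

Let E_le F G : (forall sig, F sig <= G sig) -> E F <= E G.
Proof. exact: le_expect. Qed.

Definition epoch_start e (sig : nat * nat -> b.-tuple 'I_n) : 'cV[R]_d.+2 :=
  vr_hb_power a eta be m w0 (fun e t => sig (e, t)) e.

Lemma epoch_start_ext e sig sig' :
  (forall j, (j.1 < e)%N -> (0 < j.2 < m)%N -> sig j = sig' j) ->
  epoch_start e sig = epoch_start e sig'.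
Proof.
by move=> ss'; apply: vr_hb_power_ext => e' t e't tm; exact: ss'.
Qed.

Section OneEpoch.
Variable e : nat.
Hypothesis es : (e < s)%N.

Let start := epoch_start e.
Let err sig t := iter_err (start sig) (fun t => sig (e, t)) t.
Let res sig t := iter_resid (start sig) (fun t => sig (e, t)) t.
Let noise sig t := iter_noise (start sig) (fun t => sig (e, t)) t.

Lemma expect_minibatch t
    (H : (nat * nat -> b.-tuple 'I_n) -> b.-tuple 'I_n -> R) :
  (0 < t < m)%N ->
  (forall sig sig', (forall j, j != (e, t) -> sig j = sig' j) ->
    H sig =1 H sig') ->
  E (fun sig => H sig (sig (e, t))) = E (fun sig => \sum_B mu B * H sig B).
Proof.
case: t => // t tm H_indep; have tm' : (t < m.-1)%N by rewrite ltn_predRL.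
pose i : 'I_s * 'I_m.-1 := (Ordinal es, Ordinal tm').
exact: (expect_resample B0 (@sample_key_inj s m) mu_sum (i := i)).
Qed.

Lemma epoch_past_ext t sig sig' :
  (forall j, j != (e, t) -> sig j = sig' j) ->
  start sig = start sig' /\ res sig t = res sig' t.
Proof.
move=> ss'; have st : start sig = start sig'.
  apply: epoch_start_ext => j je _; apply: ss'.
  by apply: contraTneq je => ->; rewrite ltnn.
split=> //; rewrite /res st /iter_resid /iterate; congr resid.
apply: inner_iter_ext => t' /andP[_ t't]; apply: ss'.
by apply: contraTneq t't => -[->]; rewrite ltnn.
Qed.

(** The factor [f (start sig)] makes this a conditional statement: the noise is
    centred given the start of the epoch. *)
Lemma expect_noise t (f : 'cV[R]_d.+2 -> R) v : (0 < t < m)%N ->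
  E (fun sig => f (start sig) * dot v (noise sig t)) = 0.
Proof.
move=> tm; rewrite (expect_minibatch tm
  (H := fun sig B => f (start sig) * dot v ((batch_mx a B - C) *m res sig t))).
  rewrite -[RHS](E_cst 0).
  apply: eq_expect => sig; under eq_bigr do rewrite mulrCA.
  by rewrite -mulr_sumr mean_batch_noise // mulr0.
by move=> sig sig' /epoch_past_ext[-> ->].
Qed.

Lemma expect_noise_sqn t : (0 < t < m)%N ->
  E (fun sig => sqn (noise sig t)) <=
  K * (growth ^+ t * (eta ^+ 2 * E (fun sig => tail (start sig)))).
Proof.
move=> tm; rewrite (expect_minibatch tm
  (H := fun sig B => sqn ((batch_mx a B - C) *m res sig t))); last first.
  by move=> sig sig' /epoch_past_ext[_ ->].
rewrite -!E_Z; apply: E_le => sig.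
apply: le_trans (mean_batch_noise_sqn b a sch _) _.
by rewrite ler_wpM2l ?spectral_norm_ge0 // sqn_iter_resid_le.
Qed.

(** Each coordinate of the error obeys a linear recurrence driven by centred
    noise, starting from [0]. *)
Lemma expect_err t (f : 'cV[R]_d.+2 -> R) k : (t <= m)%N ->
  E (fun sig => f (start sig) * dot (u k) (err sig t)) = 0.
Proof.
pose Z t := E (fun sig => f (start sig) * dot (u k) (err sig t)).
have Z0 t' : (forall sig, err sig t' = 0) -> Z t' = 0.
  move=> err0; rewrite -[RHS](E_cst 0).
  by apply: eq_expect => sig; rewrite err0 dot0r mulr0.
have [] : ((t <= m)%N -> Z t = 0) /\ ((t.+1 <= m)%N -> Z t.+1 = 0) => //.
elim: t => [|t [IH0 IH1]].
  by split=> _; apply: Z0 => sig; rewrite /err ?iter_err0 ?iter_err1.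
split=> // tm.
have -> : Z t.+2 = E (fun sig =>
    2 * damped (lam k) * (f (start sig) * dot (u k) (err sig t.+1))
    + (2 * eta * (f (start sig) * dot (u k) (noise sig t.+1))
       + - be * (f (start sig) * dot (u k) (err sig t)))).
  by apply: eq_expect => sig; rewrite /err dot_iter_errSS; ring.
rewrite 2!E_D 3!E_Z -/(Z t.+1) -/(Z t) expect_noise //.
by rewrite (IH1 (ltnW tm)) (IH0 (ltnW (ltnW tm))) !mulr0 !addr0.
Qed.

(** Step [t] injects noise of mean square
    [4 eta^2 E |N_t y_t|^2 <= 4 eta^2 K growth^t eta^2 E(tail)], and the error
    then grows geometrically like the iterates. *)
Lemma expect_err_sqn t : (t <= m)%N ->
  E (fun sig => sqn (err sig t)) <=
  growth ^+ t * (K * eta ^+ 4 * E (fun sig => tail (start sig))).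
Proof.
set T := E (fun sig => tail (start sig)); set Q := K * eta ^+ 4 * T.
have T0 : 0 <= T.
  rewrite -(E_cst 0).
  by apply: E_le => sig; exact: tail_ge0.
have K0 : 0 <= K := spectral_norm_ge0 _.
have e0 : 0 <= eta by case/andP: eta_bounds => /ltW.
have Q0 : 0 <= Q by rewrite !mulr_ge0 // exprn_ge0.
have k0 : 0 <= growth by apply: le_trans ler01 growth_ge1.
have M0 : 0 <= M by apply: le_trans ler01 step_bound_ge1.
pose Z t := E (fun sig => sqn (err sig t)).
have Z0 t' : (forall sig, err sig t' = 0) -> Z t' = 0.
  move=> err0; rewrite -[RHS](E_cst 0).
  by apply: eq_expect => sig; rewrite err0 sqn0.
have [] : ((t <= m)%N -> Z t <= growth ^+ t * Q) /\
    ((t.+1 <= m)%N -> Z t.+1 <= growth ^+ t.+1 * Q) => //.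
elim: t => [|t [IH0 IH1]].
  split=> _; rewrite Z0 => [|sig]; rewrite ?mulr_ge0 ?exprn_ge0 //.
    by rewrite /err iter_err0.
  by rewrite /err iter_err1.
split=> // tm; rewrite 2!exprSM.
have {}IH1 := IH1 (ltnW tm); rewrite exprSM in IH1.
have {}IH0 := IH0 (ltnW (ltnW tm)).
have gQ0 : 0 <= growth ^+ t * Q by rewrite mulr_ge0 ?exprn_ge0.
apply: (@le_trans _ _ (4 * (4 * eta ^+ 2 * E (fun sig => sqn (noise sig t.+1))
    + 4 * M * Z t.+1 + 0 + M * Z t))).
  rewrite addr0 -[4 * eta ^+ 2 * E _]E_Z -[4 * M * Z _]E_Z -[M * Z _]E_Z.
  rewrite -2!E_D -E_Z; apply: E_le => sig.
  by rewrite [_ * _ + 4 * M * _]addrC; exact: sqn_iter_errSS.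
apply: (growth_step gQ0 IH0) => //.
- have := @expect_noise_sqn t.+1 tm; rewrite -/T.
  rewrite -mulrA ler_pM2l // -exprSM => h.
  apply: le_trans (ler_wpM2l (sqr_ge0 eta) h) _.
  by rewrite le_eqVlt; apply/orP; left; apply/eqP; rewrite /Q; ring.
- by apply: ler_wpM2l; rewrite ?mulr_ge0.
- by apply: mulr_ge0; apply: mulr_ge0.
Qed.

(** The cross term between the deterministic evolution and the error has zero
    mean by [expect_err]. *)
Lemma epoch_coord k :
  E (fun sig => dot (u k) (epoch_start e.+1 sig) ^+ 2) =
  cheb m (damped (lam k)) be ^+ 2 * E (fun sig => dot (u k) (start sig) ^+ 2)
  + E (fun sig => dot (u k) (err sig m) ^+ 2).
Proof.
rewrite -[RHS]addr0 -[X in _ + X](mulr0 (2 * cheb m (damped (lam k)) be)).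
rewrite -(@expect_err m (dot (u k)) k (leqnn m)) -!E_Z -!E_D.
apply: eq_expect => sig.
have -> : epoch_start e.+1 sig =
    mean_iter (start sig) m + err sig m by rewrite /err addrC subrK.
by rewrite dotDr dot_mean_iter; ring.
Qed.

Lemma epoch_head :
  cheb m (damped (lam 0)) be ^+ 2 * E (fun sig => dot (u 0) (start sig) ^+ 2)
  <= E (fun sig => dot (u 0) (epoch_start e.+1 sig) ^+ 2).
Proof.
rewrite epoch_coord lerDl -(E_cst 0).
by apply: E_le => sig; exact: sqr_ge0.
Qed.

Lemma epoch_tail :
  E (fun sig => tail (epoch_start e.+1 sig)) <=
  (be ^+ m + growth ^+ m * K * eta ^+ 4) * E (fun sig => tail (start sig)).
Proof.
have sq0 (f : _ -> R) : 0 <= E (fun sig => f sig ^+ 2).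
  rewrite -(E_cst 0).
  by apply: E_le => sig; exact: sqr_ge0.
rewrite mulrDl {1}/tail E_sum.
under eq_bigr do rewrite epoch_coord.
rewrite big_split lerD //=.
  rewrite /tail E_sum mulr_sumr ler_sum // => k k0.
  rewrite ler_wpM2r // cheb_sqr_le // /be /beta_par -/(damped _).
  rewrite ler_pXn2r ?nnegrE ?damped_ge0 // /damped lerD2l ler_wpM2l ?lam_le1 //.
  by case/andP: eta_bounds => /ltW.
rewrite -E_sum; apply: le_trans (_ : _ <= E (fun sig => sqn (err sig m))) _.
  apply: E_le => sig; rewrite tail_parseval lerDr; exact: sqr_ge0.
by apply: le_trans (expect_err_sqn (leqnn m)) _; rewrite !mulrA.
Qed.

End OneEpoch.

Lemma epochs_tail e : (e <= s)%N ->
  E (fun sig => tail (epoch_start e sig)) <=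
  (be ^+ m + growth ^+ m * K * eta ^+ 4) ^+ e * tail w0.
Proof.
elim: e => [_|e IH es]; first by rewrite mul1r -[leRHS]E_cst.
apply: le_trans (epoch_tail es) _; rewrite exprSM ler_wpM2l ?(IH (ltnW es)) //.
have g0 : 0 <= growth by apply: le_trans ler01 growth_ge1.
have e0 : 0 <= eta by case/andP: eta_bounds => /ltW.
apply: addr_ge0; first by rewrite exprn_ge0 ?sqr_ge0.
apply: mulr_ge0; last exact: exprn_ge0.
by apply: mulr_ge0; [exact: exprn_ge0|exact: spectral_norm_ge0].
Qed.

Lemma epochs_head e : (e <= s)%N ->
  (cheb m (damped (lam 0)) be ^+ 2) ^+ e * dot (u 0) w0 ^+ 2 <=
  E (fun sig => dot (u 0) (epoch_start e sig) ^+ 2).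
Proof.
elim: e => [_|e IH es]; first by rewrite mul1r -[leLHS]E_cst.
apply: le_trans (epoch_head es).
by rewrite exprSM ler_wpM2l ?sqr_ge0 ?(IH (ltnW es)).
Qed.

End Expectations.

End Epoch.

(** * The algorithm and its finite model *)

Section LawOfEpochs.
Variables (R : realType) (disp : measure_display) (T : measurableType disp).
Variables (P : probability T R) (d n b m s : nat) (a : 'I_n -> 'cV[R]_d.+2).
Variables (lam : 'I_d.+2 -> R) (eta : R) (w0 : 'cV[R]_d.+2) (sch : sampling).
Variables (B0 : b.-tuple 'I_n) (S : nat -> nat -> T -> b.-tuple 'I_n).

(** The end of epoch [s] depends on the mini-batches of epochs [e < s] and inner
    iterations [0 < t < m] only, which are those covered by the independence
    hypothesis. *)
Lemma mean_sq_coord_expect (v : 'cV[R]_d.+2) :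
  iid_minibatches P sch m s S ->
  mean_sq_coord P v (fun x =>
    vr_hb_power a eta (beta_par eta (lam 1)) m w0 (fun e t => S e t x) s) =
  expect (@sample_key s m) B0 (minibatch_weight R sch)
    (fun sig => dot v (epoch_start a lam eta m w0 s sig) ^+ 2).
Proof.
move=> [S_unif S_ind]; rewrite /mean_sq_coord.
have key_range (i : 'I_s * 'I_m.-1) :
    ((sample_key i).1 < s)%N && (0 < (sample_key i).2 < m)%N.
  by rewrite ltn_ord /= -ltn_predRL ltn_ord.
pose Sj (j : nat * nat) := S j.1 j.2.
rewrite (@expectation_samples _ _ _ P _ _ _ (@sample_key s m) B0
  (minibatch_weight R sch) Sj _ _ _ _
  (fun sig => dot v (epoch_start a lam eta m w0 s sig) ^+ 2)) //.
- exact: sample_key_inj.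
- move=> i x; case/andP: (key_range i) => es tm.
  by have [meas _] := S_unif _ _ es tm; exact: meas.
- move=> i x; case/andP: (key_range i) => es tm.
  by have [_ law] := S_unif _ _ es tm; rewrite law.
- move=> A; pose J := [seq sample_key i | i <- enum {: 'I_s * 'I_m.-1}].
  have -> : (\bigcap_(i in [set: 'I_s * 'I_m.-1])
      (Sj (sample_key i) @^-1` A (sample_key i)) =
      \bigcap_(j in [set` J]) (S j.1 j.2 @^-1` A j))%classic.
    apply/seteqP; split=> x /= h.
      by move=> j /mapP[i _ ->]; exact: (h i).
    by move=> i _; apply: h; apply: map_f; rewrite mem_enum.
  rewrite S_ind; first by rewrite big_map big_enum.
    by rewrite map_inj_uniq ?enum_uniq //; exact: sample_key_inj.
  by move=> j /mapP[i _ ->]; exact: key_range.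
- by move=> sig; exact: sqr_ge0.
- move=> sig sig' ss'; congr (dot _ _ ^+ 2); apply: epoch_start_ext.
  move=> [e [|t]] //= es tm.
  have tm' : (t < m.-1)%N by rewrite ltn_predRL.
  exact: (ss' (Ordinal es, Ordinal tm')).
Qed.

End LawOfEpochs.

(** * Linear convergence *)

Theorem theorem3p4 (R : realType) (d n m : nat) (a : 'I_n -> 'cV[R]_d.+2)
    (lam : 'I_d.+2 -> R) (u : 'I_d.+2 -> 'cV[R]_d.+2) (sch : sampling)
    (u_eigen : orthonormal_eigenbasis (covariance_mx a) lam u)
    (lam_gap : lam 1 < lam 0)
    (lam_sorted : forall j k : 'I_d.+2, (0 < j <= k)%N -> lam k <= lam j)
    (lam_ge0 : forall k : 'I_d.+2, 0 <= lam k)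
    (m_gt0 : (0 < m)%N) :
  exists c : nat -> R,
  forall b : nat, (0 < b <= n)%N ->
  let K := variance_norm b a sch in
  exists2 etabar : R, 0 < etabar <= 1 &
  forall eta : R, 0 < eta <= etabar ->
  let be := beta_par eta (lam 1) in
  let p1 := rec_poly m (alpha_par eta (lam 0)) be in
  let p2 := rec_poly m (alpha_par eta (lam 1)) be in
  let rho := p2 / p1 + eta ^+ 4 * \sum_(1 <= l < m.+1) c l * K ^+ l in
  [/\ p1 != 0, 0 < rho < 1 &
  forall (disp : measure_display) (T : measurableType disp)
    (P : probability T R) (s : nat) (S : nat -> nat -> T -> b.-tuple 'I_n)
    (w0 : 'cV[R]_d.+2),
  iid_minibatches P sch m s S ->
  norm2 w0 = 1 -> dot (u 0) w0 != 0 ->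
  let W := fun x : T => vr_hb_power a eta be m w0 (fun e t => S e t x) s in
  0 < mean_sq_coord P (u 0) W /\
  (\sum_(k < d.+2 | k != 0) mean_sq_coord P (u k) W)
    / mean_sq_coord P (u 0) W
  <= rho ^+ s * ((1 - dot (u 0) w0 ^+ 2) / dot (u 0) w0 ^+ 2)].
Proof.
(* The factor 4 ^ m pays for the division by p1 >= 4 ^- m. *)
pose g := growth a lam; pose c1 := (4 * g) ^+ m.
have g1 : 1 <= g by exact: growth_ge1.
have c1_ge0 : 0 <= c1 by rewrite exprn_ge0 // mulr_ge0 //; lra.
exists (fun l => if l == 1%N then c1 else 0) => b b_bounds K.
have K0 : 0 <= K := spectral_norm_ge0 _.
have l0 : 0 < lam 0 by apply: le_lt_trans lam_gap; exact: lam_ge0.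
pose gap := (lam 0 - lam 1) / (1 + lam 0).
have gap_gt0 : 0 < gap by rewrite divr_gt0 ?subr_gt0 // addr_gt0.
have cK0 : 0 <= c1 * K by rewrite mulr_ge0.
have cK1 : 0 < 1 + c1 * K by lra.
(* The first bound keeps x0 away from 0; the second makes eta * c1 * K less
   than gap, so that the perturbation eta ^+ 4 * c1 * K <= eta * (eta * c1 * K)
   is less than the gain eta * gap of [ratio_le]. *)
exists (Num.min 2^-1 (gap / (1 + c1 * K))).
  rewrite lt_min invr_gt0 ltr0n divr_gt0 //=.
  by rewrite ge_min invf_le1 ?ler1n.
move=> eta /andP[eta0]; rewrite le_min => /andP[eta_half eta_gap].
have eta1 : 0 < eta <= 1 by rewrite eta0; lra.
rewrite ler_pdivlMr // in eta_gap.
move=> be p1 p2 rho.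
pose x0 := damped eta (lam 0); pose x1 := damped eta (lam 1).
have x1_ge0 : 0 <= x1 by rewrite damped_ge0.
have x1_gt0 : 0 < x1.
  by rewrite /x1 /damped; have := mulr_ge0 (ltW eta0) (lam_ge0 1); lra.
have x01 : x0 - x1 = eta * (lam 0 - lam 1) by rewrite /x0 /x1 /damped; ring.
have x1_lt : x1 < x0 by rewrite -subr_gt0 x01 mulr_gt0 // subr_gt0.
have x0_half : 2^-1 <= x0.
  by rewrite /x0 /damped; have := mulr_ge0 (ltW eta0) (ltW l0); lra.
have x0_gt0 : 0 < x0 by apply: lt_trans x1_lt.
have x0_le : x0 <= 1 + lam 0 by exact: (damped_le lam_gap lam_sorted lam_ge0).
have p1E : p1 = cheb m x0 be ^+ 2 by rewrite -rec_poly_cheb.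
have p2E : p2 = be ^+ m.
  by rewrite /p2 rec_poly_cheb /be /beta_par cheb_geom exprAC.
have p1_ge : (x0 ^+ m) ^+ 2 <= p1.
  have h : x0 ^+ m <= cheb m x0 be.
    by apply: cheb_ge; [exact: ltW|rewrite ler_pXn2r ?nnegrE // ltW].
  have xm : 0 <= x0 ^+ m by rewrite exprn_ge0 // ltW.
  by rewrite p1E ler_pXn2r // nnegrE // (le_trans xm).
have p1_gt0 : 0 < p1 by apply: lt_le_trans p1_ge; rewrite !exprn_gt0.
have growth_le_p1c1 : g ^+ m <= p1 * c1.
  rewrite /c1 (exprMn m 4 g) (mulrA p1) ler_peMl ?exprn_ge0 //; first by lra.
  apply: (@le_trans _ _ ((x0 ^+ m) ^+ 2 * 4 ^+ m)).
    rewrite exprAC -exprMn exprn_ege1 //; nra.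
  by rewrite ler_wpM2r // exprn_ge0.
have rhoE : rho = p2 / p1 + eta ^+ 4 * (c1 * K).
  rewrite /rho big_ltn //= expr1 big_nat big1 ?addr0 // => l /andP[l2 _].
  by rewrite gtn_eqF // mul0r.
have be_gt0 : 0 < be by rewrite /be /beta_par exprn_gt0.
have p2_gt0 : 0 < p2 by rewrite p2E exprn_gt0.
(* p2 / p1 <= (x1 / x0) ^ (2 m) <= x1 / x0 = 1 - eta (lam 0 - lam 1) / x0. *)
have ratio_le : p2 / p1 <= 1 - eta * gap.
  have r_le1 : x1 / x0 <= 1 by rewrite ler_pdivrMr // mul1r ltW.
  apply: (@le_trans _ _ (x1 / x0)).
    apply: (@le_trans _ _ ((x1 / x0) ^+ (m * 2))).
      rewrite exprM 2!exprMn exprVn exprVn p2E /be /beta_par exprAC.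
      rewrite ler_wpM2l ?exprn_ge0 // lef_pV2 ?posrE //.
      by rewrite !exprn_gt0.
    rewrite -[leRHS]expr1 ler_wiXn2l ?divr_ge0 ?(ltW x0_gt0) //.
    by rewrite muln_gt0 m_gt0.
  have -> : x1 / x0 = 1 - eta * ((lam 0 - lam 1) / x0).
    by rewrite mulrA -x01; field; rewrite gt_eqF.
  rewrite lerD2l lerN2 ler_pM2l // /gap ler_pM2l ?subr_gt0 //.
  have l1 : 0 < 1 + lam 0 by rewrite addr_gt0.
  by rewrite lef_pV2 // posrE.
split; first by rewrite gt_eqF.
- rewrite rhoE; apply/andP; split.
    by apply: ltr_wpDr; [rewrite mulr_ge0 ?exprn_ge0 // ltW|rewrite divr_gt0].
  have h : eta ^+ 4 * (c1 * K) <= eta * (eta * (c1 * K)).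
    rewrite [leRHS]mulrA ler_wpM2r // -expr2 ler_wiXn2l //; first exact: ltW.
    by case/andP: eta1.
  have := mulr_gt0 eta0 eta0; nra.
move=> disp T P s S w0 iid w0_norm w0_head W.
have /card_gt0P[B0 _] := card_minibatches_gt0 sch b_bounds.
pose E := expect (@sample_key s m) B0 (minibatch_weight R sch).
pose Z (sig : nat * nat -> b.-tuple 'I_n) := epoch_start a lam eta m w0 s sig.
have meanE v : mean_sq_coord P v W = E (fun sig => dot v (Z sig) ^+ 2).
  exact: mean_sq_coord_expect.
have headE : p1 ^+ s * dot (u 0) w0 ^+ 2 <=
    E (fun sig => dot (u 0) (Z sig) ^+ 2).
  by rewrite p1E; exact: epochs_head.
have tailE : E (fun sig => tail u (Z sig)) <=
    (be ^+ m + g ^+ m * K * eta ^+ 4) ^+ s * tail u w0.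
  exact: epochs_tail.
have h0 : 0 < dot (u 0) w0 ^+ 2 by rewrite lt_neqAle eq_sym sqr_ge0 expf_neq0.
have head_gt0 : 0 < E (fun sig => dot (u 0) (Z sig) ^+ 2).
  by apply: lt_le_trans headE; apply: mulr_gt0 => //; exact: exprn_gt0.
rewrite meanE; split=> //.
have -> : \sum_(k < d.+2 | k != 0) mean_sq_coord P (u k) W =
    E (fun sig => tail u (Z sig)).
  by rewrite /E /tail expect_sum; apply: eq_bigr => k _; rewrite meanE.
have tail0 : tail u w0 = 1 - dot (u 0) w0 ^+ 2.
  have := tail_parseval u_eigen w0; rewrite -norm2_sqr w0_norm; lra.
rewrite -tail0 ler_pdivrMr //.
have rho_step : be ^+ m + g ^+ m * K * eta ^+ 4 <= rho * p1.
  rewrite rhoE mulrDl divfK ?gt_eqF // p2E lerD2l.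
  have -> : eta ^+ 4 * (c1 * K) * p1 = (p1 * c1) * K * eta ^+ 4 by ring.
  have eta4 : 0 <= eta ^+ 4 by rewrite exprn_ge0 // ltW.
  by apply: ler_wpM2r => //; exact: ler_wpM2r.
have rho0 : 0 <= rho.
  rewrite rhoE; apply: addr_ge0; first by rewrite ltW ?divr_gt0.
  by apply: mulr_ge0 => //; rewrite exprn_ge0 // ltW.
apply: le_trans tailE _.
apply: (@le_trans _ _ ((rho * p1) ^+ s * tail u w0)).
  rewrite ler_wpM2r ?tail_ge0 // lerXn2r ?nnegrE //.
    apply: addr_ge0; first by rewrite -p2E ltW.
    apply: mulr_ge0; last by rewrite exprn_ge0 ?ltW.
    by rewrite mulr_ge0 // exprn_ge0 //; lra.
  by rewrite mulr_ge0 // ltW.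
have -> : (rho * p1) ^+ s * tail u w0 =
    rho ^+ s * (tail u w0 / dot (u 0) w0 ^+ 2) * (p1 ^+ s * dot (u 0) w0 ^+ 2).
  by rewrite exprMn; field.
by rewrite ler_wpM2l // mulr_ge0 ?exprn_ge0 // divr_ge0 ?tail_ge0 ?sqr_ge0.
Qed.
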